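(* Let $K$ be a division ring, $S$ a ring endomorphism of $K$, $D$ an $S$-derivation of $K$ and $R=K[t;S,D]$. Let $h\in R$ and let $\Delta\subseteq K$ be an algebraic set disjoint from $V(h)$. Then: (1) $\phi_h(\Delta)$ is an algebraic set. (2) $\operatorname{rk}\phi_h(\Delta)=\operatorname{rk}\Delta-\operatorname{rk}\bigl(\overline{\Delta}\cap V(h)\bigr)$. (3) $\operatorname{rk}\phi_h(\Delta)=\operatorname{rk}\Delta$ if and only if $\overline{\Delta}\cap V(h)=\emptyset$.
   Context: An $S$-derivation is an additive map $D:K\to K$ with $D(ab)=S(a)D(b)+D(a)b$. $R=K[t;S,D]$ is the Ore ring of skew polynomials $\sum a_it^i$ ($a_i\in K$) with $ta=S(a)t+D(a)$. For $f\in R$, $a\in K$ write $f=q\,(t-a)+b$ with $q\in R$, $b\in K$; then $f(a):=b$, and $V(f):=\{a\in K: f(a)=0\}$. A subset $\Delta\subseteq K$ is algebraic if some nonzero polynomial of $R$ vanishes at every element of $\Delta$. For an algebraic set $\Delta$, $f_\Delta$ is the monic polynomial of minimal degree in $R$ vanishing on $\Delta$, and $\overline{\Delta}:=\{x\in K: f_\Delta(x)=0\}$. An element $a\in K$ is $P$-dependent over an algebraic set $\Delta$ if every polynomial of $R$ vanishing on $\Delta$ vanishes at $a$. A subset $B$ of an algebraic set $\Delta$ is a $P$-basis of $\Delta$ if no $b\in B$ is $P$-dependent over $B\setminus\{b\}$ and every element of $\Delta$ is $P$-dependent over $B$. The rank $\operatorname{rk}\Delta$ is the cardinality of a $P$-basis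 of $\Delta$. For $a\in K$ and $c\in K\setminus\{0\}$, $a^c:=S(c)ac^{-1}+D(c)c^{-1}$. For $h\in R$, $\phi_h:K\setminus V(h)\to K$ is the map $\phi_h(x):=x^{h(x)}$. *)

(* Defs.v *)
From HB Require Import structures.
From mathcomp Require Import all_boot all_order all_algebra.
From mathcomp Require Import finmap.
From mathcomp Require Import boolp classical_sets functions cardinality.

Set Implicit Arguments.
Unset Strict Implicit.
Unset Printing Implicit Defensive.

Import GRing.Theory.
Local Open Scope ring_scope.
Local Open Scope classical_set_scope.
Local Open Scope card_scope.

Record sderivation (K : nzRingType) (S : {rmorphism K -> K}) := SDerivation {
  sder :> K -> K;
  sderD : {morph sder : a b / a + b};
  sderM : forall a b, sder (a * b) = S a * sder b + sder a * b
}.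

(* The Ore ring K[t; S, D]: its additive group is that of {poly K}, a list of *)
(* coefficients a_i standing for \sum_i a_i t^i (coefficients on the left);   *)
(* only the product differs. The operations of the polynomial ring {poly K}   *)
(* itself must therefore not be used on it multiplicatively.                  *)
Definition ore (K : nzRingType) (S : {rmorphism K -> K}) (D : sderivation S) :=
  {poly K}.

Section OreRing.
Variables (K : nzRingType) (S : {rmorphism K -> K}) (D : sderivation S).

HB.instance Definition _ := GRing.Lmodule.on (ore D).

Lemma sder0 : D 0 = 0.
Proof. by apply: (addrI (D 0)); rewrite -sderD !addr0. Qed.

(* Left multiplication by t: t * (b t^j) = S(b) t^(j+1) + D(b) t^j. *)
Definition ore_tmul (q : {poly K}) : {poly K} :=
  map_poly S q * 'X + map_poly D q.

Definition ore_mul (p q : ore D) : ore D :=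
  \sum_(i < size p) p`_i *: iter i ore_tmul q.

Lemma coef_ore_tmul q i :
  (ore_tmul q)`_i = (if i is j.+1 then S q`_j else 0) + D q`_i.
Proof.
by rewrite coefD coefMX coef_map (coef_map_id0 _ _ sder0); case: i.
Qed.

Lemma ore_tmulD p q : ore_tmul (p + q) = ore_tmul p + ore_tmul q.
Proof.
apply/polyP => -[|i]; rewrite (coefD (ore_tmul _)) !coef_ore_tmul !coefD sderD.
  by rewrite !add0r.
by rewrite rmorphD addrACA.
Qed.

Lemma ore_tmul0 : ore_tmul 0 = 0.
Proof. by apply: (addrI (ore_tmul 0)); rewrite -ore_tmulD !addr0. Qed.

Lemma ore_tmulZ a p : ore_tmul (a *: p) = S a *: ore_tmul p + D a *: p.
Proof.
apply/polyP => -[|i];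
  rewrite (coefD (_ *: _)) !coefZ !coef_ore_tmul !coefZ sderM ?add0r //.
by rewrite rmorphM mulrDr addrA.
Qed.

Lemma iter_ore_tmulD n p q :
  iter n ore_tmul (p + q) = iter n ore_tmul p + iter n ore_tmul q.
Proof. by elim: n => //= n ->; rewrite ore_tmulD. Qed.

Lemma iter_ore_tmul0 n : iter n ore_tmul 0 = 0.
Proof. by elim: n => //= n ->; rewrite ore_tmul0. Qed.

Lemma ore_mulE n (p q : ore D) : (size p <= n)%N ->
  ore_mul p q = \sum_(i < n) p`_i *: iter i ore_tmul q.
Proof.
move=> lepn; rewrite /ore_mul 
  (big_ord_widen n (fun i => p`_i *: iter i ore_tmul q) lepn) big_mkcond /=.
apply: eq_bigr => i _; case: ltnP => // ?.
by rewrite [p`_i]nth_default // scale0r.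
Qed.

Lemma ore_mulDl : left_distributive ore_mul +%R.
Proof.
move=> p q r; set n := maxn (size p) (size q).
rewrite (@ore_mulE n (p + q)) ?size_polyD //.
rewrite (@ore_mulE n p) ?leq_maxl // (@ore_mulE n q) ?leq_maxr //.
rewrite -big_split /=; apply: eq_bigr => i _.
by rewrite (@coefD _ p q) scalerDl.
Qed.

Lemma ore_mulDr : right_distributive ore_mul +%R.
Proof.
move=> p q r; rewrite /ore_mul -big_split /=; apply: eq_bigr => i _.
by rewrite iter_ore_tmulD scalerDr.
Qed.

Lemma ore_mul0r q : ore_mul 0 q = 0.
Proof. by rewrite (@ore_mulE 0) ?size_poly0 ?big_ord0. Qed.

Lemma ore_mulZl a p q : ore_mul (a *: p) q = a *: ore_mul p q.
Proof.
rewrite (@ore_mulE (size p)) ?size_scale_leq // /ore_mul scaler_sumr.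
by apply: eq_bigr => i _; rewrite (@coefZ _ a p) scalerA.
Qed.

Lemma ore_mulXn j q : ore_mul 'X^j q = iter j ore_tmul q.
Proof.
rewrite (@ore_mulE j.+1) ?size_polyXn // big_ord_recr /= big1 ?add0r => [|i _].
  by rewrite coefXn eqxx scale1r.
by rewrite coefXn (ltn_eqF (ltn_ord i)) scale0r.
Qed.

Lemma ore_mul_suml n (F : 'I_n -> ore D) q :
  ore_mul (\sum_(i < n) F i) q = \sum_(i < n) ore_mul (F i) q.
Proof.
by apply: (big_morph (ore_mul^~ q)) => [x y|]; rewrite ?ore_mulDl ?ore_mul0r.
Qed.

Lemma sder1 : D 1 = 0.
Proof.
apply: (addrI (D 1)); rewrite addr0.
by rewrite -[in RHS](mulr1 1) sderM rmorph1 mul1r mulr1.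
Qed.

Lemma ore_tmulXn i : ore_tmul 'X^i = 'X^(i.+1).
Proof.
apply/polyP => k; rewrite coef_ore_tmul !coefXn.
have -> b : D (b : bool)%:R = 0 by case: b; rewrite ?sder1 ?sder0.
by case: k => [|k]; rewrite ?coefXn ?eqSS ?rmorph_nat addr0.
Qed.

Lemma ore_mul_tmul p q : ore_mul (ore_tmul p) q = ore_tmul (ore_mul p q).
Proof.
rewrite -[p in LHS]coefK poly_def.
have morphT := big_morph ore_tmul ore_tmulD ore_tmul0.
rewrite [ore_mul p q]/ore_mul !morphT ore_mul_suml; apply: eq_bigr => i _.
rewrite !ore_tmulZ ore_tmulXn ore_mulDl !ore_mulZl.
by rewrite !ore_mulXn.
Qed.

Lemma ore_mulA : associative ore_mul.
Proof.
move=> p q r; rewrite [ore_mul p q]/ore_mul ore_mul_suml.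
rewrite [LHS]/ore_mul; apply: eq_bigr => i _.
rewrite ore_mulZl; congr (_ *: _).
by elim: (nat_of_ord i) => //= n ->; rewrite ore_mul_tmul.
Qed.

Lemma ore_mul1l : left_id (1%:P : ore D) ore_mul.
Proof. by move=> q; exact: (ore_mulXn 0). Qed.

Lemma ore_mul1r : right_id (1%:P : ore D) ore_mul.
Proof.
move=> p; rewrite /ore_mul -[RHS]coefK poly_def; apply: eq_bigr => i _.
congr (_ *: _); rewrite -[1%:P in LHS](expr0 'X).
by elim: (nat_of_ord i) => //= n ->; rewrite ore_tmulXn.
Qed.

Lemma ore_1neq0 : (1%:P : ore D) != 0.
Proof. exact: (oner_neq0 {poly K}). Qed.

HB.instance Definition _ := GRing.Zmodule_isNzRing.Build (ore D)
  ore_mulA ore_mul1l ore_mul1r ore_mulDl ore_mulDr ore_1neq0.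

Definition orec (a : K) : ore D := a%:P.
Definition oret : ore D := 'X.

Lemma orec_mul a (p : ore D) : orec a * p = a *: p.
Proof.
rewrite -[LHS]/(ore_mul a%:P p) (@ore_mulE 1) ?size_polyC_leq1 //.
by rewrite big_ord1 coefC.
Qed.

Lemma oret_mul (p : ore D) : oret * p = ore_tmul p.
Proof. exact: (ore_mulXn 1). Qed.

Lemma oret_exp i : oret ^+ i = 'X^i :> {poly K}.
Proof.
by elim: i => [|i IH]; rewrite ?exprS ?expr0 // oret_mul IH ore_tmulXn exprS.
Qed.

Lemma orecB : {morph orec : a b / a - b}.
Proof. exact: polyCB. Qed.

Lemma orecM : {morph orec : a b / a * b}.
Proof. by move=> a b; rewrite orec_mul -[LHS]/((a * b)%:P) polyCM mul_polyC. Qed.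

Lemma oret_orec a : oret * orec a = orec (S a) * oret + orec (D a).
Proof.
rewrite oret_mul orec_mul /ore_tmul map_polyC mul_polyC; congr (_ + _).
by apply/polyP => i; rewrite (coef_map_id0 _ _ sder0) !coefC; case: i => //= i;
  rewrite sder0.
Qed.

Lemma ore_expand (f : ore D) : f = \sum_(i < size f) orec f`_i * oret ^+ i.
Proof.
rewrite -[LHS]coefK poly_def; apply: eq_bigr => i _.
by rewrite orec_mul oret_exp.
Qed.


Lemma orecD : {morph orec : a b / a + b}.
Proof. exact: polyCD. Qed.

Lemma orec0 : orec 0 = 0.
Proof. exact: polyC0. Qed.

Lemma orec1 : orec 1 = 1.
Proof. by []. Qed.

(* f(a) is the b in K such that f = q (t - a) + b for some q; it exists and   *)
(* is unique by oevalP below.                                                 *)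
Definition oeval (f : ore D) (a : K) : K :=
  xget 0 [set b | exists q : ore D, f = q * (oret - orec a) + orec b].

Definition zeros (f : ore D) : set K := [set a | oeval f a = 0].

Definition vanishes_on (Delta : set K) (f : ore D) :=
  forall x, Delta x -> oeval f x = 0.

Definition algebraic (Delta : set K) :=
  exists2 f : ore D, f != 0 & vanishes_on Delta f.

Definition is_minpoly (Delta : set K) (f : ore D) :=
  [/\ f \is monic, vanishes_on Delta f &
      forall g : ore D, g \is monic -> vanishes_on Delta g ->
        (size f <= size g)%N].

Definition minpoly (Delta : set K) : ore D := xget 0 (is_minpoly Delta).

Definition algebraic_closure (Delta : set K) : set K := zeros (minpoly Delta).

Definition P_dependent (Delta : set K) (a : K) :=
  forall f : ore D, vanishes_on Delta f -> oeval f a = 0.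

Definition P_basis (Delta B : set K) :=
  [/\ B `<=` Delta,
      forall b, B b -> ~ P_dependent (B `\ b) b &
      forall x, Delta x -> P_dependent B x].

(* Over a division ring every algebraic set has a P-basis, and all its        *)
(* P-bases are finite of the same cardinality: see rkP below.                 *)
Definition rk (Delta : set K) : nat :=
  xget 0%N [set n | exists2 B, P_basis Delta B & B #= `I_n].

Lemma ore_eval_exists f a :
  exists b, exists q : ore D, f = q * (oret - orec a) + orec b.
Proof.
have Xn i : exists b, exists q : ore D, oret ^+ i = q * (oret - orec a) + orec b.
  elim: i => [|i [b [q IH]]]; first by exists 1, 0; rewrite mul0r add0r.
  exists (S b * a + D b), (oret * q + orec (S b)).
  rewrite exprS IH mulrDr oret_orec mulrA mulrDl -addrA; congr (_ + _).
  by rewrite orecD orecM mulrBr addrA subrK.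
rewrite (ore_expand f).
apply: (big_ind (fun g => exists b, exists q : ore D,
   g = q * (oret - orec a) + orec b)).
- by exists 0, 0; rewrite mul0r add0r.
- move=> _ _ [b [q ->]] [c [r ->]]; exists (b + c), (q + r).
  by rewrite orecD mulrDl addrACA.
- move=> i _; have [b [q ->]] := Xn i.
  by exists (f`_i * b), (orec f`_i * q); rewrite mulrDr mulrA orecM.
Qed.

Lemma size_iter_ore_tmul i (q : {poly K}) :
  (size (iter i ore_tmul q) <= size q + i)%N.
Proof.
elim: i => [|i IH] /=; first by rewrite addn0.
apply/leq_sizeP => j; rewrite addnS => lt_ij; rewrite coef_ore_tmul.
case: j lt_ij => // j; rewrite ltnS => le_ij.
rewrite !nth_default ?rmorph0 ?sder0 ?addr0 //; last exact: leq_trans le_ij.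
by apply: leq_trans IH _; exact: leqW.
Qed.

Lemma size_ore_mulC (q : ore D) a : (size (q * orec a)%R <= size q)%N.
Proof.
apply: (leq_trans (size_sum _ _ _)); apply/bigmax_leqP => i _.
apply: (leq_trans (size_scale_leq _ _)).
apply: (leq_trans (size_iter_ore_tmul _ _)).
rewrite addnC; apply: leq_trans (ltn_ord i).
by rewrite -addn1 leq_add2l size_polyC_leq1.
Qed.

Lemma ore_mulX (q : ore D) : q * oret = (q : {poly K}) * 'X.
Proof.
rewrite [in LHS](ore_expand q) -[in RHS](coefK q) poly_def !mulr_suml.
apply: eq_bigr => i _; rewrite -mulrA -exprSr orec_mul oret_exp.
by rewrite -scalerAl -exprSr.
Qed.

Lemma oeval_uniq (q : ore D) a b : q * (oret - orec a) = orec b -> b = 0.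
Proof.
have [-> /esym|q0] := eqVneq q 0; first by rewrite mul0r => /polyC_inj.
rewrite mulrBr ore_mulX => /(congr1 (fun p : {poly K} => p`_(size q))).
rewrite (@coefB _ ((q : {poly K}) * 'X)) coefC coefMX size_poly_eq0 (negPf q0).
rewrite -lead_coefE (nth_default _ (size_ore_mulC q a)) subr0 => /eqP.
by rewrite lead_coef_eq0 (negPf q0).
Qed.

Lemma oevalP f a b :
  oeval f a = b <-> exists q : ore D, f = q * (oret - orec a) + orec b.
Proof.
have ex := ore_eval_exists f a.
have [q0 E] : exists q : ore D, f = q * (oret - orec a) + orec (oeval f a).
  by have := xgetPex 0 ex.
split=> [<-|[q]]; first by exists q0.
rewrite {1}E => E1; apply/eqP; rewrite eq_sym -subr_eq0; apply/eqP.
apply: (@oeval_uniq (q0 - q) a); set x := oret - _ in E1 *.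
by rewrite mulrBl orecB -(addrK (orec (oeval f a)) (q0 * x)) E1
  addrAC [q * x + _]addrC addrK.
Qed.

End OreRing.

Section DivisionRing.
Variables (K : unitRingType) (S : {rmorphism K -> K}) (D : sderivation S).
Implicit Types (f g : ore D) (A B Delta : set K) (x : K).

(* a^c, meant for c != 0. *)
Definition sconj (a c : K) : K := S c * a * c^-1 + D c * c^-1.

(* Defined on the whole of K, but only meant outside of zeros h. *)
Definition phi (h : ore D) (x : K) : K := sconj x (oeval h x).

Hypothesis fieldK : GRing.field_axiom K.

Lemma oevalE f a : exists q : ore D, f = q * (oret D - orec D a) + orec D (oeval f a).
Proof. exact/oevalP. Qed.

Lemma oevalD f g a : oeval (f + g) a = oeval f a + oeval g a.
Proof.
have [[p Ep] [q Eq]] := (oevalE f a, oevalE g a).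
apply/oevalP; exists (p + q).
by rewrite {1}Ep {1}Eq orecD mulrDl addrACA.
Qed.

Lemma oevalZ c f a : oeval (c *: f) a = c * oeval f a.
Proof.
have [p Ep] := oevalE f a; apply/oevalP; exists (orec D c * p).
by rewrite -orec_mul {1}Ep orecM mulrDr mulrA.
Qed.

Lemma oeval0 a : oeval (0 : ore D) a = 0.
Proof. by apply/oevalP; exists 0; rewrite mul0r add0r. Qed.

Lemma oeval1 a : oeval (1 : ore D) a = 1.
Proof. by apply/oevalP; exists 0; rewrite mul0r add0r. Qed.

Lemma oevalB f g a : oeval (f - g) a = oeval f a - oeval g a.
Proof. by rewrite oevalD -scaleN1r oevalZ mulN1r. Qed.

Lemma oevalM0 f g a : oeval g a = 0 -> oeval (f * g) a = 0.
Proof.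
move=> /oevalP[q ->]; apply/oevalP; exists (f * q).
by rewrite orec0 !addr0 mulrA.
Qed.

Lemma oeval_root f b : oeval f b != 0 ->
  oeval ((oret D - orec D (sconj b (oeval f b))) * f) b = 0.
Proof.
move=> nz; have [p Ep] := oevalE f b; set c := oeval f b in nz Ep *.
set d := sconj b c; apply/oevalP.
exists ((oret D - orec D d) * p + orec D (S c)).
have Ed : d * c = S c * b + D c.
  by rewrite /d /sconj mulrDl !mulrVK ?fieldK.
rewrite orec0 addr0 {1}Ep mulrDr [RHS]mulrDl mulrA; congr (_ + _).
rewrite mulrBl oret_orec -orecM Ed mulrBr -orecM orecD opprD addrACA.
by rewrite subrr addr0.
Qed.

Lemma size_ore_tmul (p : {poly K}) : p \is monic ->
  size (ore_tmul D p) = (size p).+1 /\ ore_tmul D p \is monic.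
Proof.
move=> monp; have p1 := monicP monp.
have p0 : size p != 0%N by rewrite size_poly_eq0 monic_neq0.
have cE : (ore_tmul D p)`_(size p) = 1.
  rewrite coef_ore_tmul [p`_(size p)]nth_default // sder0 addr0.
  by move: p1; rewrite lead_coefE; case: (size p) p0 => //= n _ ->; exact: rmorph1.
have sE : size (ore_tmul D p) = (size p).+1.
  apply/eqP; rewrite eqn_leq; apply/andP; split.
    by have := size_iter_ore_tmul D 1 p; rewrite addn1.
  rewrite ltnNge; apply/negP => le_s; have := oner_neq0 K.
  by rewrite -cE nth_default // eqxx.
by split=> //; rewrite monicE lead_coefE sE /= cE.
Qed.

Lemma monic_step f a : f \is monic ->
  size ((oret D - orec D a) * f) = (size f).+1 /\
  (oret D - orec D a) * f \is monic.
Proof.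
move=> monf; have [sE monE] := size_ore_tmul monf.
rewrite mulrBl oret_mul orec_mul.
have lt_s : (size (- (a *: f)) < size (ore_tmul D f))%N.
  by rewrite size_polyN sE ltnS size_scale_leq.
split; first by rewrite (size_polyDl lt_s).
by rewrite monicE (lead_coefDl lt_s) -monicE.
Qed.

Lemma monic_texp k f : f \is monic ->
  size (oret D ^+ k * f) = (size f + k)%N /\ oret D ^+ k * f \is monic.
Proof.
move=> monf; elim: k => [|k [IHs IHm]]; first by rewrite mul1r addn0.
by rewrite exprS -mulrA oret_mul addnS -IHs; apply: size_ore_tmul.
Qed.

Lemma vanishesZ B c f : vanishes_on B f -> vanishes_on B (c *: f).
Proof. by move=> vf x /vf fx; rewrite oevalZ fx mulr0. Qed.

Lemma vanishes_monic B g : g != 0 -> vanishes_on B g ->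
  exists g' : ore D,
    [/\ g' \is monic, vanishes_on B g' & (size g' <= size g)%N].
Proof.
move=> g0 vg; exists ((lead_coef g)^-1 *: g).
split; [|exact: vanishesZ|exact: size_scale_leq].
have lu : lead_coef g \is a GRing.unit by rewrite fieldK ?lead_coef_eq0.
have e : ((lead_coef g)^-1 *: (g : {poly K}))`_(size g).-1 = 1.
  by rewrite coefZ -lead_coefE mulVr.
have sE : size ((lead_coef g)^-1 *: (g : {poly K})) = size g.
  apply/eqP; rewrite eqn_leq size_scale_leq /= leqNgt; apply/negP => lt_s.
  have := oner_neq0 K; rewrite -e nth_default ?eqxx //.
  by rewrite -ltnS (ltn_predK lt_s).
by rewrite monicE lead_coefE sE e.
Qed.

Lemma minpoly_exists Delta : algebraic D Delta ->
  exists f : ore D, is_minpoly Delta f.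
Proof.
move=> [f f0 vf]; have [g [mong vg _]] := vanishes_monic f0 vf.
pose P n := `[< exists g : ore D, [/\ g \is monic, vanishes_on Delta g
  & size g = n] >].
have exP : exists n, P n by exists (size g); apply/asboolP; exists g.
case: (ex_minnP exP) => n /asboolP[p [monp vp sp]] min_n.
exists p; split=> // q monq vq; rewrite sp.
by apply: min_n; apply/asboolP; exists q.
Qed.

Lemma minpolyP Delta : algebraic D Delta ->
  is_minpoly Delta (minpoly D Delta).
Proof. by move=> /minpoly_exists /(xgetPex 0). Qed.

Lemma minpoly_lt B f g : is_minpoly B f -> vanishes_on B g ->
  (size g < size f)%N -> g = 0.
Proof.
move=> [_ _ minf] vg lt_gf; apply/eqP/negPn/negP => g0.
have [g' [mong' vg' le_g]] := vanishes_monic g0 vg.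
by have := leq_ltn_trans le_g lt_gf; rewrite ltnNge minf.
Qed.

Lemma size_subr_monic (p q : {poly K}) : p \is monic -> q \is monic ->
  size p = size q -> (size (p - q)%R < size p)%N.
Proof.
move=> monp monq eq_s.
have p0 : (0 < size p)%N by rewrite size_poly_gt0 monic_neq0.
rewrite -(prednK p0) ltnS; apply/leq_sizeP => j le_j; rewrite coefB.
move: le_j; rewrite leq_eqVlt => /predU1P[<-|].
  rewrite {2}eq_s -!lead_coefE (monicP monp) (monicP monq); exact: subrr.
by rewrite prednK // => le_j; rewrite !nth_default ?subr0 // -eq_s.
Qed.

Lemma minpoly_uniq Delta f g :
  is_minpoly Delta f -> is_minpoly Delta g -> f = g.
Proof.
move=> mf mg; have [monf vf minf] := mf; have [mong vg ming] := mg.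
have eq_s : size f = size g by apply/eqP; rewrite eqn_leq minf ?ming.
apply/eqP; rewrite -subr_eq0; apply/eqP; apply: (minpoly_lt mf).
  by move=> x Dx; rewrite oevalB vf ?vg ?subr0.
exact: size_subr_monic.
Qed.

Lemma minpoly_dep B f b : is_minpoly B f -> oeval f b = 0 -> P_dependent D B b.
Proof.
move=> mf fb g; have [monf vf _] := mf.
have [n] := ubnP (size g); elim: n => // n IHn in g *; rewrite ltnS => le_gn vg.
have [lt_gf|le_fg] := ltnP (size g) (size f).
  by rewrite (minpoly_lt mf vg lt_gf) oeval0.
pose k := (size g - size f)%N; pose u := oret D ^+ k * f.
have [su monu] := monic_texp k monf; rewrite -/u subnKC // in su monu.
have f0 : (0 < size f)%N by rewrite size_poly_gt0 monic_neq0.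
have g0 : (0 < size g)%N by apply: leq_trans le_fg.
have lt_s : (size (g - lead_coef g *: u)%R < size g)%N.
  rewrite -[ltnRHS](prednK g0) ltnS; apply/leq_sizeP => j le_j.
  rewrite (@coefB _ g) (@coefZ _ _ u).
  move: le_j; rewrite leq_eqVlt => /predU1P[<-|].
    have -> : u`_(size g).-1 = 1 by rewrite -su -lead_coefE (monicP monu).
    by rewrite mulr1 -lead_coefE; exact: subrr.
  by rewrite prednK // => le_j; rewrite !nth_default ?mulr0 ?subr0 ?su.
have v x : oeval f x = 0 -> oeval (lead_coef g *: u) x = 0.
  by move=> fx; rewrite oevalZ oevalM0 ?mulr0.
have := IHn _ (leq_trans lt_s le_gn); rewrite oevalB (v _ fb) subr0; apply.
by move=> x Bx; rewrite oevalB vg // v ?subr0 // vf.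
Qed.

Lemma minpoly_depP B f b : is_minpoly B f ->
  P_dependent D B b <-> oeval f b = 0.
Proof.
by move=> mf; split; [apply; case: mf | exact: minpoly_dep].
Qed.

Lemma algebraic_sub B Delta : B `<=` Delta -> algebraic D Delta -> algebraic D B.
Proof. by move=> sub [f f0 vf]; exists f => // x /sub /vf. Qed.

Lemma P_dependent_sub A B a : A `<=` B -> P_dependent D A a -> P_dependent D B a.
Proof. by move=> sub dep f vf; apply: dep => x /sub /vf. Qed.

Lemma minpoly_same A B f : is_minpoly A f ->
  (forall g, vanishes_on A g <-> vanishes_on B g) -> is_minpoly B f.
Proof.
move=> [monf vf minf] e; split=> //; first exact/e.
by move=> g mong /e; exact: minf.
Qed.

(* Adding a point x to A multiplies the minimal polynomial by a linear factor *)
(* if x is P-independent over A, and leaves it unchanged otherwise.           *)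
Lemma minpoly_add A f x : is_minpoly A f ->
  exists2 g : ore D, is_minpoly (x |` A) g &
    size g = (size f + (oeval f x != 0%R))%N.
Proof.
move=> mf; have [monf vf minf] := mf.
have [fx|fx] := eqVneq (oeval f x) 0.
  exists f; last by rewrite addn0.
  apply: (minpoly_same mf) => g; split=> vg y; last by move=> Ay; apply: vg; right.
  by case=> [->|]; [exact: (minpoly_dep mf fx) | exact: vg].
pose g := (oret D - orec D (sconj x (oeval f x))) * f.
have [sg mong] : size g = (size f).+1 /\ g \is monic by exact: monic_step.
exists g; last by rewrite sg addn1.
split=> // [y [->|/vf fy]|h monh vh]; first exact: oeval_root.
  exact: oevalM0.
rewrite sg ltnNge; apply/negP => le_hf.
have vhA : vanishes_on A h by move=> y Ay; apply: vh; right.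
have eq_s : size h = size f by apply/eqP; rewrite eqn_leq le_hf minf.
have mh : is_minpoly A h by split=> // p monp vp; rewrite eq_s minf.
by move: fx; rewrite (minpoly_uniq mf mh) vh ?eqxx //; left.
Qed.

Lemma minpoly0 : is_minpoly set0 (1 : ore D).
Proof.
split=> [|//|g mong _]; first exact: (monic1 K).
by rewrite [size _](size_poly1 K) size_poly_gt0 monic_neq0.
Qed.

Definition P_free B := forall b, B b -> ~ P_dependent D (B `\ b) b.

Lemma P_free_sub A B : A `<=` B -> P_free B -> P_free A.
Proof.
move=> sAB freeB c Ac dep; apply: (freeB c (sAB _ Ac)).
by apply: P_dependent_sub dep => y [Ay ?]; split=> //; exact: sAB.
Qed.

Lemma card_setD1 B b n : B #= `I_n.+1 -> B b -> B `\ b #= `I_n.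
Proof.
move=> cardB Bb; have finB : finite_set B by apply/finite_setP; exists n.+1.
have sX := card_fset_set cardB.
have eB : B `\ b = [set` (fset_set B `\ b)%fset].
  apply/seteqP; split=> y /=; rewrite !inE in_fset_set //.
    by move=> [By /eqP ->]; rewrite mem_set.
  by move=> /andP[/eqP ? /set_mem].
rewrite eB; apply/card_eq_fsetP.
move: sX; rewrite (cardfsD1 b) in_fset_set // mem_set // add1n.
by case.
Qed.

Lemma card_setU1 A x n : A #= `I_n -> ~ A x -> x |` A #= `I_n.+1.
Proof.
move=> cardA nAx; have finA : finite_set A by apply/finite_setP; exists n.
have sX := card_fset_set cardA.
have eA : x |` A = [set` (x |` fset_set A)%fset].
  apply/seteqP; split=> y /=; rewrite !inE in_fset_set //.
    by case=> [->|Ay]; rewrite ?eqxx // mem_set // orbT.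
  by case/predU1P => [->|/set_mem]; [left | right].
rewrite eA; apply/card_eq_fsetP; rewrite cardfsU1 sX in_fset_set //.
by rewrite memNset.
Qed.

Lemma card_minpoly B n : B #= `I_n ->
  exists f : ore D, [/\ is_minpoly B f, (size f <= n.+1)%N &
    size f = n.+1 <-> P_free B].
Proof.
elim: n B => [|n IHn] B.
  rewrite II0 card_eq0 => /eqP ->; exists 1; split=> //; first exact: minpoly0.
    by rewrite [size _](size_poly1 K).
  by split=> [_ b []|_] //; exact: (size_poly1 K).
move=> cardB; have del b : B b -> B `\ b #= `I_n by exact: card_setD1.
have [b Bb] : B !=set0.
  apply/set0P/eqP => B0; move: cardB; rewrite B0 card_eq_sym card_eq0 => /eqP.
  by move=> /(congr1 (fun A : set nat => A 0%N)) /= e; rewrite -e.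
have [g [mg le_g gP]] := IHn _ (del b Bb).
have [f mf sf] := minpoly_add b mg; rewrite setD1K // in mf.
exists f; split=> //.
  by rewrite sf -(addn1 n.+1) leq_add // leq_b1.
split=> [sfn c Bc|freeB].
  have [p [mp le_p _]] := IHn _ (del c Bc).
  have [q mq sq] := minpoly_add c mp; rewrite setD1K // in mq.
  move: sq; rewrite -(minpoly_uniq mf mq) sfn => sq /(minpoly_depP _ mp) pc.
  by move: le_p; rewrite pc eqxx addn0 in sq; rewrite -sq ltnn.
have [_ sg] := gP; rewrite sf sg; last by apply: P_free_sub freeB => y [].
have -> : oeval g b != 0; last by rewrite addn1.
by apply/eqP => /(minpoly_depP _ mg); exact: freeB.
Qed.

Lemma P_basis_card Delta B f :
  is_minpoly Delta f -> P_basis D Delta B -> B #= `I_(size f).-1.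
Proof.
move=> mf [sBD freeB dep]; have [monf vf minf] := mf.
have /finite_setP[n cardB] : finite_set B.
  apply: contrapT => /(infinite_set_fset (size f))[X sX le_f].
  have /card_minpoly[g [[_ _ ming] _ [_ sg]]] : [set` X] #= `I_#|`X|.
    exact/card_eq_fsetP.
  have := ming f monf; rewrite sg; last exact: P_free_sub freeB.
  have vX : vanishes_on [set` X] f by move=> x /sX /sBD /vf.
  by move=> /(_ vX) /leq_trans /(_ le_f); rewrite ltnn.
have [g [mg _ [_ sg]]] := card_minpoly cardB.
suff -> : f = g by rewrite sg.
apply: (minpoly_uniq mf); apply: minpoly_same mg _ => h; split=> vh x.
  by move=> /dep; apply.
by move=> /sBD /vh.
Qed.

Lemma P_basis_exists Delta : algebraic D Delta -> exists B, P_basis D Delta B.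
Proof.
move=> algD; have [f mf] := minpoly_exists algD; have [monf vf minf] := mf.
pose P n := `[< exists B, [/\ B `<=` Delta, P_free B & B #= `I_n] >].
have exP : exists n, P n.
  by exists 0%N; apply/asboolP; exists set0; split=> //; rewrite II0.
have bndP n : P n -> (n <= size f)%N.
  move=> /asboolP[B [sB freeB /card_minpoly[g [[_ _ ming] _ [_ sg]]]]].
  apply: ltnW; rewrite -sg //; apply: ming => // x /sB; exact: vf.
case: (ex_maxnP exP bndP) => n /asboolP[B [sB freeB cardB]] max_n.
exists B; split=> // x Dx; apply: contrapT => ndep.
have [g [mg _ [_ sg]]] := card_minpoly cardB.
have nBx : ~ B x by move=> Bx; apply: ndep => h; apply.
have gx : oeval g x != 0 by apply/eqP => /(minpoly_dep mg).
have [h mh sh] := minpoly_add x mg.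
have cardU := card_setU1 cardB nBx.
suff /max_n : P n.+1 by rewrite ltnn.
apply/asboolP; exists (x |` B); split=> //; first by move=> y [->|/sB].
have [k [mk _ [fk _]]] := card_minpoly cardU; apply: fk.
by rewrite (minpoly_uniq mk mh) sh sg // gx addn1.
Qed.

Lemma rkP Delta B : algebraic D Delta -> P_basis D Delta B -> B #= `I_(rk D Delta).
Proof.
move=> algD basB; have mf := minpolyP algD.
have ex : [set n | exists2 C, P_basis D Delta C & C #= `I_n]
    (size (minpoly D Delta)).-1.
  by exists B => //; exact: P_basis_card mf basB.
have [C basC cardC] := xgetI 0%N ex.
apply: card_eq_trans (P_basis_card mf basB) _.
by apply: card_eq_trans cardC; rewrite card_eq_sym (P_basis_card mf basC).
Qed.

End DivisionRing.

(* Main.v *)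
Require Import Defs.
From HB Require Import structures.
From mathcomp Require Import all_boot all_order all_algebra.
From mathcomp Require Import boolp classical_sets functions cardinality.

Set Implicit Arguments.
Unset Strict Implicit.
Unset Printing Implicit Defensive.

Import GRing.Theory.
Local Open Scope ring_scope.
Local Open Scope classical_set_scope.

(** Write f for the minimal polynomial of Delta and A for the set of common
zeros of f and h. The rank of an algebraic set is the degree of its minimal
polynomial, so the claim is that the minimal polynomial p of phi_h(Delta) has
degree rk Delta - rk A. By the product formula (g h)(x) = g(phi_h(x)) h(x), valid
when h(x) <> 0, a polynomial g vanishes on phi_h(Delta) exactly when g h
vanishes on Delta.

Upper bound ([linear_multiple_vanishing]). A polynomial that vanishes on A, such
as h, can be made to vanish on all of Delta by multiplying it on the left by
linear factors t - c: each factor kills one more point of Delta, chosen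
P-independent from the points already killed, so rk Delta - rk A factors are
enough. The product of these factors vanishes on phi_h(Delta).

Lower bound ([minpoly_common_zeros_prod]). Passing from g to (t - c) g enlarges
the set of common zeros with f by at most one unit of rank. Indeed all new
zeros y satisfy phi_g(y) = c, and any two of them span a line, inside the zeros
of f, which meets the zeros of g ([sconj_line]); so one new zero suffices to
generate all the others over the old ones. Now the first construction,
applied to the constant 1 and the set phi_h(Delta), gives a product of
at most rk phi_h(Delta) linear factors which vanishes on phi_h(Delta). Multiplying h by
it, one passes from A to all the zeros of f, so that
rk Delta <= rk A + rk phi_h(Delta). *)

Section DivisionRing.
Variables (K : unitRingType) (S : {rmorphism K -> K}) (D : sderivation S).
Implicit Types (f g h q : ore D) (A Delta : set K) (a b c x y : K).

Hypothesis divK : GRing.field_axiom K.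

Lemma mulr_eq0_left a b : b != 0 -> a * b = 0 -> a = 0.
Proof. by move=> b0 e; rewrite -[a](mulrK (divK b0)) e mul0r. Qed.

Lemma oeval_orec a x : oeval (orec D a) x = a.
Proof. by apply/oevalP; exists 0; rewrite mul0r add0r. Qed.

Lemma oeval_linear c x : oeval (oret D - orec D c) x = x - c.
Proof. by apply/oevalP; exists 1; rewrite mul1r orecB addrA subrK. Qed.

(** Modulo left multiples of t - phi_h(x) the left factor g is the constant
g(phi_h(x)), and (t - phi_h(x)) h vanishes at x by the choice of phi_h(x). *)
Lemma oevalM_phi g h x : oeval h x != 0 ->
  oeval (g * h) x = oeval g (phi h x) * oeval h x.
Proof.
move=> hx; have [q Eq] := oevalE g (phi h x).
rewrite {1}Eq mulrDl oevalD orec_mul oevalZ -mulrA oevalM0 ?add0r //.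
exact: oeval_root.
Qed.

Lemma phi_eq_of_root c g y : oeval g y != 0 ->
  oeval ((oret D - orec D c) * g) y = 0 -> phi g y = c.
Proof.
move=> gy; rewrite oevalM_phi // oeval_linear => e.
by apply/eqP; rewrite -subr_eq0; apply/eqP; exact: mulr_eq0_left e.
Qed.

Lemma sconjK x b : b != 0 -> sconj D (sconj D x b) b^-1 = x.
Proof.
move=> b0; have ub := divK b0.
rewrite /sconj invrK mulrDr !mulrA mulrDl -rmorphM mulVr // rmorph1 mul1r.
rewrite !mulrVK // -addrA -sderM mulVr // sder1 addr0 //.
Qed.

(** The map v |-> oeval (q * orec v) c is additive, which turns the zeros of q in
the conjugacy class of c into the nonzero vectors of an additive group. *)
Lemma oeval_sconj q c v : v != 0 ->
  oeval (q * orec D v) c = oeval q (sconj D c v) * v.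
Proof. by move=> v0; rewrite oevalM_phi /phi oeval_orec. Qed.

(** The third point of the line through two conjugates of c: values of q at the
three points are tied by one linear relation, so that vanishing at two of them
forces vanishing at the third. *)
Lemma sconj_line q c u v : u != 0 -> v != 0 -> u - v != 0 ->
  oeval q (sconj D c (u - v)) * (u - v) =
  oeval q (sconj D c u) * u - oeval q (sconj D c v) * v.
Proof.
by move=> u0 v0 uv0; rewrite -!oeval_sconj // orecB mulrBr oevalB.
Qed.

Lemma is_minpoly_algebraic A g : is_minpoly A g -> algebraic D A.
Proof. by case=> mong vg _; exists g => //; exact: (monic_neq0 mong). Qed.

Lemma rk_minpoly A g : is_minpoly A g -> rk D A = (size g).-1.
Proof.
move=> mg; have algA := is_minpoly_algebraic mg.
have [B basB] := P_basis_exists divK algA.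
rewrite -(card_fset_set (rkP divK algA basB)).
exact: card_fset_set (P_basis_card divK mg basB).
Qed.

(** Each point x of Delta at which the minimal polynomial of A does not vanish
raises the degree of that polynomial by one and costs one factor; the degree
never exceeds that of f, because f vanishes on the enlarged A. *)
Lemma linear_multiple_vanishing A Delta f g q :
  is_minpoly A g -> f \is monic -> vanishes_on A f -> vanishes_on Delta f ->
  vanishes_on A q ->
  exists2 cs : seq K, (size cs + size g <= size f)%N &
    vanishes_on Delta (\prod_(c <- cs) (oret D - orec D c) * q).
Proof.
move=> mg monf + vD; have [n] := ubnP (size f - size g).
elim: n => // n IHn in A g q mg *; rewrite ltnS => le_n vA qA.
have le_gf : (size g <= size f)%N by case: mg => _ _; apply.
have [sDg|/existsNP[x /not_implyP[Dx /eqP gx]]] := pselect (vanishes_on Delta g).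
  exists [::]; first by rewrite add0n.
  by move=> x /sDg gx; rewrite big_nil mul1r; exact: (minpoly_dep divK mg gx).
have [g' mg' sg'] := minpoly_add divK x mg.
rewrite gx addn1 in sg'.
pose q' := (oret D - orec D (phi q x)) * q.
have q'x : oeval q' x = 0.
  have [qx|qx] := eqVneq (oeval q x) 0; first exact: oevalM0.
  exact: oeval_root.
have vA' : vanishes_on (x |` A) f by move=> y [->|/vA //]; exact: vD.
have le_g'f : (size g' <= size f)%N by case: mg' => _ _; apply.
have [||y [->|/qA qy]|cs lecs vcs] := IHn _ _ q' mg' => //.
- rewrite sg' in le_g'f *.
  by apply: leq_trans le_n; rewrite ltn_sub2l.
- exact: oevalM0.
exists (rcons cs (phi q x)).
  by rewrite size_rcons addSnnS -sg'.
by rewrite -cats1 big_cat big_seq1 /= -mulrA.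
Qed.

Definition common_zeros f g : set K := zeros f `&` zeros g.

Lemma common_zeros_minpoly f g : f != 0 -> exists e : ore D, is_minpoly (common_zeros f g) e.
Proof. by move=> f0; apply: minpoly_exists => //; exists f => // x []. Qed.

(** A single new zero y1 of (t - c) g generates all the others over the common
zeros of f and g: the line through y1 and another new zero y meets the zeros of
g in a common zero of f and g, and y lies on the line through it and y1. *)
Lemma minpoly_common_zeros_linear f g c (e e' : ore D) :
  is_minpoly (common_zeros f g) e ->
  is_minpoly (common_zeros f ((oret D - orec D c) * g)) e' ->
  (size e' <= (size e).+1)%N.
Proof.
move=> me [_ _ mine']; have [mone ve _] := me.
set Z := common_zeros f _ in mine'.
have [sZ|/existsNP[y1 /not_implyP[[fy1 cgy1] /eqP gy1]]] :=
  pselect (forall y, Z y -> oeval g y = 0).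
  apply/leqW/mine' => // y Zy; apply: ve; split; last exact: sZ.
  by case: Zy.
have [e1 me1 se1] := minpoly_add divK y1 me; have [mone1 ve1 _] := me1.
apply: (@leq_trans (size e1)); last first.
  by rewrite se1 -addn1 leq_add2l leq_b1.
apply: mine' => // y [fy cgy].
have [gy|gy] := eqVneq (oeval g y) 0; first by apply: ve1; right.
have [->|ny] := eqVneq y y1; first by apply: ve1; left.
have cE : forall w, oeval g w != 0 ->
    oeval ((oret D - orec D c) * g) w = 0 ->
    (oeval g w)^-1 != 0 /\ sconj D c (oeval g w)^-1 = w.
  move=> w gw cw; split; first by rewrite invr_eq0.
  by rewrite -(phi_eq_of_root gw cw) sconjK.
have [u0 uE] := cE y gy cgy; have [v0 vE] := cE y1 gy1 cgy1.
set u := (oeval g y)^-1 in u0 uE; set v := (oeval g y1)^-1 in v0 vE.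
(* The vectors u and v are scaled so that g takes the value 1 on both of them:
   hence g kills u - v. *)
have uv0 : u - v != 0.
  by rewrite subr_eq0; apply: contra_neq ny => uv; rewrite -uE uv.
have line q := sconj_line q c u0 v0 uv0.
rewrite uE vE in line; set z := sconj D c (u - v) in line.
have fz : oeval f z = 0.
  by apply: (mulr_eq0_left uv0); rewrite line fy fy1 !mul0r subr0.
have gz : oeval g z = 0.
  by apply: (mulr_eq0_left uv0); rewrite line /u /v !mulrV ?divK // subrr.
apply: (mulr_eq0_left u0).
have := line e1; rewrite [oeval e1 z]ve1; last by right.
by rewrite [oeval e1 y1]ve1; [rewrite !mul0r subr0 | left].
Qed.

Lemma minpoly_common_zeros_prod f h (cs : seq K) (e e' : ore D) : f != 0 ->
  is_minpoly (common_zeros f h) e ->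
  is_minpoly (common_zeros f (\prod_(c <- cs) (oret D - orec D c) * h)) e' ->
  (size e' <= size e + size cs)%N.
Proof.
move=> f0 me; elim: cs e' => [|c cs IH] e'.
  by rewrite big_nil mul1r => /(minpoly_uniq divK me) ->; rewrite addn0.
rewrite big_cons -mulrA => me'.
have [e1 me1] :=
  common_zeros_minpoly (\prod_(c <- cs) (oret D - orec D c) * h) f0.
apply: leq_trans (minpoly_common_zeros_linear me1 me') _.
by rewrite addnS ltnS; exact: IH.
Qed.

Lemma rk_eq0 A : algebraic D A -> rk D A = 0%N <-> A = set0.
Proof.
move=> algA; have mg := minpolyP divK algA; have [mong vg _] := mg.
split=> [|->]; last first.
  by rewrite (rk_minpoly (minpoly0 D)) [size _](size_poly1 K).
rewrite (rk_minpoly mg) => s0; apply/seteqP; split=> // x Ax.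
have s1 : (size (minpoly D A) <= 1)%N by rewrite -subn_eq0 subn1 s0.
have := vg x Ax; have /= := size1_polyC s1.
move: mong; rewrite monicE lead_coefE s0 => /eqP -> ->.
by move=> /eqP; rewrite -[1%:P]/(1 : ore D) oeval1 oner_eq0.
Qed.

Lemma vanishes_on_phi_image h g Delta : Delta `&` zeros h = set0 ->
  vanishes_on (phi h @` Delta) g <-> vanishes_on Delta (g * h).
Proof.
move=> disj; have nz x : Delta x -> oeval h x != 0.
  by move=> Dx; apply/eqP => hx; have : (Delta `&` zeros h) x by []; rewrite disj.
split=> [v x Dx|v _ [x Dx <-]].
  by rewrite oevalM_phi ?nz // v ?mul0r //; exists x.
by apply: (mulr_eq0_left (nz x Dx)); rewrite -oevalM_phi ?nz ?v.
Qed.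

Lemma monic_linear_prod (cs : seq K) :
  (\prod_(c <- cs) (oret D - orec D c) : ore D) \is monic /\
  size (\prod_(c <- cs) (oret D - orec D c) : ore D) = (size cs).+1.
Proof.
elim: cs => [|c cs [IHm IHs]].
  by rewrite big_nil; split; [exact: (monic1 K) | exact: (size_poly1 K)].
rewrite big_cons; have [-> ?] := monic_step c IHm.
by split=> //=; rewrite IHs.
Qed.

End DivisionRing.

Theorem theorem3p6 (K : unitRingType) (divK : GRing.field_axiom K)
    (S : {rmorphism K -> K}) (D : sderivation S)
    (h : ore D) (Delta : set K)
    (algDelta : algebraic D Delta) (disj : Delta `&` zeros h = set0) :
  [/\ algebraic D (phi h @` Delta),
      (rk D (phi h @` Delta))%:Z =
        (rk D Delta)%:Z - (rk D (algebraic_closure D Delta `&` zeros h))%:Z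
    & rk D (phi h @` Delta) = rk D Delta <->
        algebraic_closure D Delta `&` zeros h = set0].
Proof.
set A := _ `&` zeros h; set X := phi h @` Delta.
have mf := minpolyP divK algDelta; have [monf vf _] := mf.
set f := minpoly D Delta in mf monf vf.
have f0 : f != 0 by exact: (monic_neq0 monf).
have [g mg] : exists g : ore D, is_minpoly A g := common_zeros_minpoly divK h f0.
have vAf : vanishes_on A f by move=> x [].
have vAh : vanishes_on A h by move=> x [].
have [cs lecs vcs] := linear_multiple_vanishing divK mg monf vAf vf vAh.
have [moncs scs] := monic_linear_prod D cs.
have vX := (vanishes_on_phi_image divK _ disj).2 vcs.
have algX : algebraic D X.
  by exists (\prod_(c <- cs) (oret D - orec D c)) => //; exact: (monic_neq0 moncs).
have mp := minpolyP divK algX; have [monp vp minp] := mp.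
set p := minpoly D X in mp monp vp minp.
have le_p : (size p <= (size cs).+1)%N by rewrite -scs; exact: minp.
have v0 (q : ore D) : vanishes_on set0 q by [].
have [ds leds vds] := linear_multiple_vanishing divK (minpoly0 D) monp
  (v0 p) vp (v0 1).
rewrite mulr1 in vds.
rewrite [size (1 : ore D)](size_poly1 K) addn1 in leds.
have vdsD := (vanishes_on_phi_image divK _ disj).1 vds.
(* These common zeros lie between Delta and the zeros of f. *)
have mf' : is_minpoly
    (common_zeros f (\prod_(c <- ds) (oret D - orec D c) * h)) f.
  apply: (minpoly_same mf) => q; split=> vq x.
    by case=> fx _; exact: (minpoly_dep divK mf fx).
  by move=> Dx; apply: vq; split; [exact: vf | exact: vdsD].
have le_f := minpoly_common_zeros_prod divK f0 mg mf'.
have rkE : (rk D X + rk D A = rk D Delta)%N.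
  rewrite (rk_minpoly divK mp) (rk_minpoly divK mg) (rk_minpoly divK mf).
  have g0 : (0 < size g)%N.
    by case: mg => mong _ _; rewrite size_poly_gt0 monic_neq0.
  have p0 : (0 < size p)%N by rewrite size_poly_gt0 monic_neq0.
  have sf0 : (0 < size f)%N by rewrite size_poly_gt0 monic_neq0.
  move: lecs le_f leds le_p.
  rewrite -(prednK g0) -(prednK p0) -(prednK sf0) addnS addSn !ltnS /=.
  move=> le_cs le_f le_ds le_p; apply/eqP; rewrite eqn_leq; apply/andP; split.
    by apply: leq_trans le_cs; rewrite leq_add2r.
  by apply: leq_trans le_f _; rewrite addnC leq_add2r.
split=> //.
  by rewrite -rkE PoszD addrK.
rewrite -(rk_eq0 divK (is_minpoly_algebraic mg)) -rkE; split=> [e|->].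
  by apply/eqP; rewrite -(eqn_add2l (rk D X)) addn0 -e.
by rewrite addn0.
Qed.
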